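(* For all $t=1,\dots,m$ and all $s\in\mathbb{N}$ one has $$I_t^{(s)}=\sum I_t^{a_t}I_{t+1}^{a_{t+1}}\cdots I_m^{a_m},$$ where the sum is extended over all sequences of non-negative integers $a_t,a_{t+1},\dots,a_m$ with $a_t+2a_{t+1}+\cdots+(m-t+1)a_m=s$.
   Context: Let $\mathbb{K}$ be a field, let $n\ge 1$ and $c\geq 1$ be integers, and let $R=\mathbb{K}[x_1,\dots,x_n]$. Set $m=\lfloor \frac{n+c}{c+1}\rfloor$. For $1\le t\le m$ let $X_t$ be the $t\times (n-(t-1)c)$ matrix whose $(i,j)$ entry is $x_{j+(i-1)c}$ (an extended Hankel matrix), and let $I_t\subset R$ be the ideal generated by all $t$-minors of $X_t$. Each $I_t$ is a prime ideal. The $s$th symbolic power of a prime ideal $I$ of $R$ is $I^{(s)}=R\cap I^sR_I=\{x\in R:\ fx\in I^s \text{ for some } f\in R\setminus I\}$. *)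

(* Defs.v *)
From HB Require Import structures.
From mathcomp Require Import all_boot all_order all_algebra.
From mathcomp Require Import mpoly.
Set Implicit Arguments.
Unset Strict Implicit.
Unset Printing Implicit Defensive.
Import GRing.Theory.
Local Open Scope ring_scope.

(* Ideals of a commutative ring are represented as Prop-valued predicates on
   the ring, since no decidability of membership is available in general. *)
Section Ideals.
Variable R : comNzRingType.
Implicit Types (S I J : R -> Prop) (x : R).

Definition ideal_gen S x : Prop :=
  exists (k : nat) (a g : 'I_k -> R),
    (forall i, S (g i)) /\ x = \sum_(i < k) a i * g i.

Definition ideal_one : R -> Prop := fun=> True.

Definition ideal_mul I J : R -> Prop :=
  ideal_gen (fun x => exists u v, [/\ I u, J v & x = u * v]).

Definition ideal_exp I (s : nat) : R -> Prop := iter s (ideal_mul I) ideal_one.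

(* The sum of the ideals F i over all i satisfying P; T may be infinite. *)
Definition ideal_sum (T : Type) (P : T -> Prop) (F : T -> R -> Prop)
    : R -> Prop :=
  ideal_gen (fun x => exists2 i, P i & F i x).

(* Meant for a prime ideal I, where it is the contraction to R of the
   extension of I^s to the localization of R at I. *)
Definition symbolic_power I (s : nat) : R -> Prop :=
  fun x => exists2 f, ~ I f & ideal_exp I s (f * x).

Definition is_minor (p q k : nat) (A : 'M[R]_(p, q)) (x : R) : Prop :=
  exists (f : 'I_k -> 'I_p) (g : 'I_k -> 'I_q),
    [/\ {homo f : i j / (i < j)%N}, {homo g : i j / (i < j)%N}
      & x = \det (mxsub f g A)].

Definition minor_ideal (p q k : nat) (A : 'M[R]_(p, q)) : R -> Prop :=
  ideal_gen (is_minor k A).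

End Ideals.

Lemma hankel_index_proof (n c t : nat) (i : 'I_t)
    (j : 'I_(n - t.-1 * c)) : (j + i * c < n)%N.
Proof.
have le_it : (i <= t.-1)%N by rewrite -ltnS (ltn_predK (ltn_ord i)).
apply: leq_ltn_trans (_ : j + t.-1 * c < n)%N.
  by rewrite leq_add2l leq_mul2r le_it orbT.
by rewrite addnC -ltn_subRL.
Qed.

Definition hankel_index (n c t : nat) (i : 'I_t) (j : 'I_(n - t.-1 * c)) : 'I_n :=
  Ordinal (hankel_index_proof i j).

(* With indices from 0, the entry x_{j+(i-1)c} of the 1-based matrix becomes
   x_{j+ic}.  The size is the intended one for 1 <= t <= (n+c) %/ (c+1). *)
Definition ext_hankel (K : fieldType) (n c t : nat)
    : 'M[{mpoly K[n]}]_(t, n - t.-1 * c) :=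
  \matrix_(i, j) 'X_(hankel_index i j).

Definition hankel_ideal (K : fieldType) (n c t : nat) : {mpoly K[n]} -> Prop :=
  minor_ideal t (ext_hankel K n c t).
Arguments hankel_ideal : clear implicits.

(* Main.v *)
(** Order monomials by mpoly's degree-lexicographic order, for which the leading
    monomial of a maximal minor is its diagonal.  The leading monomials of the
    t-minors of X_t are then the products of x_i over the chains of length t,
    i.e. the sequences with consecutive gaps larger than c.

    Let V be the family of matrices of rank at most r = t - 1 obtained as sums
    of r generic points of the rational scroll, x_j = lambda_(j mod c) u^(j / c).
    This gives a morphism phi from R to a domain killing I_t.  Translating a
    polynomial f by one more point of the scroll and expanding in divided
    derivatives shows, by induction on r, that phi f <> 0 as soon as the leading
    monomial of f contains no chain of length t.  Hence I_t = ker phi, I_t is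
    prime, and the t-minors form a Groebner basis.

    If x is in I_t^(s), all divided derivatives of x of order < s are in I_t.
    Differentiating the leading monomial of x completely with respect to the
    variables outside a set F without chains of length t yields an element whose
    leading monomial is supported in F, hence not in I_t: so the leading monomial
    of x has degree at least s outside each such F.  A min-max theorem of
    Greene-Kleitman type, proved by removing greedy chains, then shows that it is
    divisible by a product of chains with sum of (length - t + 1) equal to s,
    and division by products of minors gives one inclusion.  The other one is
    Sylvester's identity on bordered minors. *)
From HB Require Import structures.
From mathcomp Require Import all_boot all_order all_fingroup all_algebra.
From mathcomp Require Import mpoly.
From mathcomp Require Import zify.
From Stdlib Require Import Classical.
Require Import Defs.
Set Implicit Arguments.
Unset Strict Implicit.
Unset Printing Implicit Defensive.
Import Order.TTheory GRing.Theory.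

(** * Packing chains *)

(* The largest weight carried by [r] disjoint windows of [c + 1] consecutive
   integers below [e]; near 0 windows are shortened by the truncated
   subtraction. *)
Fixpoint max_windows (c : nat) (a : nat -> nat) (r e : nat) : nat :=
  if r is r'.+1 then
    \max_(k < e.+1) (\sum_(k - c.+1 <= i < k) a i
                     + max_windows c a r' (k - c.+1))
  else 0.

Section MaxWindows.
Variables (c : nat) (a : nat -> nat).
Implicit Types r e k : nat.

Lemma sum_nat_cat i j k : i <= j -> j <= k ->
  \sum_(i <= l < k) a l = \sum_(i <= l < j) a l + \sum_(j <= l < k) a l.
Proof. by move=> ij jk; rewrite (big_cat_nat ij jk). Qed.

Lemma max_windows_ge r e k : k <= e ->
  \sum_(k - c.+1 <= i < k) a i + max_windows c a r (k - c.+1)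
    <= max_windows c a r.+1 e.
Proof.
rewrite -ltnS => ke /=.
exact: (@leq_bigmax _ (fun k : 'I_e.+1 => \sum_(k - c.+1 <= i < k) a i
  + max_windows c a r (k - c.+1)) (Ordinal ke)).
Qed.

Lemma max_windows_attained r e : exists2 k, k <= e &
  max_windows c a r.+1 e
    = \sum_(k - c.+1 <= i < k) a i + max_windows c a r (k - c.+1).
Proof.
have ne : 0 < #|'I_e.+1| by rewrite card_ord.
have [k _ E] := @eq_bigmax_cond _ predT (fun k : 'I_e.+1 =>
  \sum_(k - c.+1 <= i < k) a i + max_windows c a r (k - c.+1)) ne.
by exists (val k); [rewrite -ltnS ltn_ord | exact: E].
Qed.

Lemma leq_max_windows r e1 e2 : e1 <= e2 ->
  max_windows c a r e1 <= max_windows c a r e2.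
Proof.
case: r => [//|r] e12; have [k ke ->] := max_windows_attained r e1.
by apply: max_windows_ge; apply: leq_trans ke e12.
Qed.

Lemma max_windows_le_sum r e : max_windows c a r e <= \sum_(0 <= i < e) a i.
Proof.
elim: r e => [//|r IH] e; have [k ke ->] := max_windows_attained r e.
have := IH (k - c.+1).
have := @sum_nat_cat 0 (k - c.+1) k.
have := @sum_nat_cat 0 k e.
lia.
Qed.

(** If the top window of an optimal family ends beyond [e1], it is moved down to end at [e1], and
    induction shortens the rest; at most the weight in [[e1, e2)] is lost. *)
Lemma max_windows_shrink r e1 e2 : e1 <= e2 ->
  max_windows c a r e2 <= max_windows c a r e1 + \sum_(e1 <= i < e2) a i.
Proof.
elim: r e1 e2 => [//|r IH] e1 e2 e12.
have [k ke ->] := max_windows_attained r e2.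
have [ke1|ke1] := leqP k e1; first by have := max_windows_ge r ke1; lia.
have := IH (e1 - c.+1) (k - c.+1).
have := max_windows_ge r (leqnn e1).
have := @sum_nat_cat (e1 - c.+1) (k - c.+1) k.
have := @sum_nat_cat (e1 - c.+1) e1 k.
have := @sum_nat_cat e1 k e2.
lia.
Qed.

End MaxWindows.

(** * Removing a chain that covers the support *)

Section GreedyChain.
Variables (c : nat) (a : nat -> nat) (C : pred nat).
Implicit Types r e k : nat.
Hypothesis gapC : forall i j, C i -> C j -> i < j -> i + c < j.
Hypothesis suppC : forall i, C i -> 0 < a i.
Hypothesis coverC : forall i, 0 < a i -> exists2 j, C j & j <= i <= j + c.

Let cnt e := \sum_(0 <= i < e) C i.

Lemma cntS e : cnt e.+1 = cnt e + C e.
Proof. by rewrite /cnt big_nat_recr. Qed.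

Lemma leq_cnt e1 e2 : e1 <= e2 -> cnt e1 <= cnt e2.
Proof. by move=> e12; rewrite /cnt (big_cat_nat (leq0n e1) e12) leq_addr. Qed.

Lemma cnt_last e : 0 < cnt e -> exists x,
  [/\ x < e, C x, cnt e = (cnt x).+1 & forall y, C y -> y < e -> y <= x].
Proof.
elim: e => [|e IH]; first by rewrite /cnt big_geq.
rewrite cntS; case Ce: (C e).
  by move=> _; exists e; split=> //; rewrite addn1.
rewrite addn0 => /IH [x [xe Cx cx maxx]]; exists x; split=> //; first exact: ltnW.
move=> y Cy; rewrite ltnS leq_eqVlt => /predU1P[yE|]; last exact: maxx.
by rewrite yE Ce in Cy.
Qed.

Lemma sum_after_last x e k : C x -> (forall y, C y -> y < e -> y <= x) ->
  x + c < k -> \sum_(k <= i < e) a i = 0.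
Proof.
move=> Cx maxx xk; rewrite big_nat_cond big1 // => i; rewrite andbT => /andP[ki ie].
apply/eqP; rewrite -leqn0 leqNgt; apply/negP => /coverC[j Cj /andP[ji ijc]].
have := maxx j Cj (leq_ltn_trans ji ie); lia.
Qed.

(** The windows starting at the elements of [C] below [e] carry all the weight, by [coverC], and
    there are at most [r] of them. *)
Lemma max_windows_cover r e : cnt e <= r ->
  max_windows c a r e = \sum_(0 <= i < e) a i.
Proof.
move=> ce; apply/eqP; rewrite eqn_leq max_windows_le_sum /=.
elim: r e ce => [|r IH] e ce; have [c0|c0] := posnP (cnt e).
- rewrite big_nat_cond big1 // => i; rewrite andbT => /andP[_ ie].
  apply/eqP; rewrite -leqn0 leqNgt; apply/negP => /coverC[j Cj /andP[ji _]].
  have := @leq_cnt j.+1 e; rewrite cntS Cj; lia.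
- lia.
- rewrite big_nat_cond big1 // => i; rewrite andbT => /andP[_ ie].
  apply/eqP; rewrite -leqn0 leqNgt; apply/negP => /coverC[j Cj /andP[ji _]].
  have := @leq_cnt j.+1 e; rewrite cntS Cj; lia.
have [x [xe Cx cx maxx]] := cnt_last c0.
have tail := @sum_after_last x e _ Cx maxx.
have [exc|exc] := leqP e (x + c.+1).
  have := max_windows_ge c a r (leqnn e).
  have := IH (e - c.+1).
  have := @leq_cnt (e - c.+1) x.
  have := @sum_nat_cat a 0 (e - c.+1) e.
  lia.
have := @max_windows_ge c a r e (x + c.+1).
have := IH x.
have := @sum_nat_cat a 0 x e.
have := @sum_nat_cat a x (x + c.+1) e.
have := tail (x + c.+1).
rewrite addnK; lia.
Qed.

Lemma sum_subC i j : i <= j ->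
  \sum_(i <= l < j) (a l - C l) + (cnt j - cnt i) = \sum_(i <= l < j) a l.
Proof.
move=> ij; rewrite {1}/cnt (big_cat_nat (leq0n i) ij) /= -/(cnt i) addKn -big_split.
apply: eq_bigr => l _ /=.
by case Cl: (C l) => /=; [have := suppC Cl; lia | lia].
Qed.

(** [cnt] grows by at most one at each step. *)
Lemma cnt_attains r k e : k <= e -> cnt k <= r -> r <= cnt e ->
  exists2 e', k <= e' <= e & cnt e' = r.
Proof.
move=> /subnKC <-; elim: (e - k) => [|d IH] kr rd.
  by exists k; [lia | move: rd; rewrite addn0; lia].
rewrite addnS cntS in rd.
have [rd'|rd'] := leqP r (cnt (k + d)).
  by have [e' ? ?] := IH kr rd'; exists e' => //; lia.
by exists (k + d).+1; [lia | rewrite cntS; lia].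
Qed.

(* A window of an optimal family that misses [C] lies, within the support of [a],
   in the window starting at the preceding element of [C]. *)
Lemma max_windows_subC r e : r <= cnt e ->
  max_windows c (fun i => a i - C i) r e + r <= max_windows c a r e.
Proof.
elim: r e => [//|r IH] e re; set a' := fun i => a i - C i in IH *.
have [k ke ->] := max_windows_attained c a' r e.
have cnt0 : cnt 0 = 0 by rewrite /cnt big_geq.
have sub i j : i <= j ->
  \sum_(i <= l < j) a' l + (cnt j - cnt i) = \sum_(i <= l < j) a l by exact: sum_subC.
(* If [C] has at most [r + 1] elements below [k], it has exactly [r + 1] below some [e' >= k]; there
   [r + 1] windows carry all of [a], which exceeds [a'] by [r + 1]. *)
have [kr|kr] := leqP (cnt k) r.+1.
  have [e' /andP[ke' e'e] ce'] := cnt_attains ke kr re.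
  have := leq_max_windows c a r.+1 e'e.
  rewrite max_windows_cover ?ce' //.
  have := @max_windows_le_sum c a' r (k - c.+1).
  have := @sum_nat_cat a' 0 (k - c.+1) k.
  have := @sum_nat_cat a' 0 k e'.
  have := sub 0 e' isT; rewrite ce' cnt0.
  lia.
have [|x [xk Cx cx maxx]] := @cnt_last k; first by lia.
(* A window containing [x] contains no other element of [C], by the gaps, so its weight in [a] is
   one more than in [a']. *)
have [xkc|kxc] := leqP (k - c.+1) x.
  have := max_windows_ge c a r ke.
  have := IH (k - c.+1).
  have : cnt k <= cnt (k - c.+1) + 1.
    have [x0|c0] := posnP (cnt x); first by rewrite cx x0; lia.
    have [y [yx Cy cy _]] := cnt_last c0.
    have := gapC Cy Cx yx.
    have := @leq_cnt y.+1 (k - c.+1); rewrite cntS Cy.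
    lia.
  have := @leq_cnt (k - c.+1) x.
  have := sub (k - c.+1) k.
  lia.
have := @sum_after_last x k (x + c.+1) Cx maxx.
have := max_windows_ge c a r (_ : x + c.+1 <= e).
rewrite addnK.
have := @max_windows_shrink c a' r x (k - c.+1).
have := IH x.
have := sub x k.
have := @sum_nat_cat a x (x + c.+1) k.
have := @sum_nat_cat a' x (k - c.+1) k.
lia.
Qed.
End GreedyChain.

(** * Chains as sequences and the min-max theorem *)

Definition chain (c : nat) : pred (seq nat) := pairwise (fun i j => i + c < j).

Lemma chain_uniq c s : chain c s -> uniq s.
Proof.
rewrite uniq_pairwise; apply: sub_pairwise => i j /=.
by move=> ij; rewrite neq_ltn (leq_ltn_trans (leq_addr c i) ij).
Qed.

(** [F] is the union of an optimal family of windows; a chain has at most one element in each of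
    them. *)
Lemma max_windows_set c a r e : exists2 F : pred nat,
  (forall s, chain c s -> all F s -> size s <= r /\ all (fun i => i < e) s) &
  max_windows c a r e = \sum_(0 <= i < e | F i) a i.
Proof.
elim: r e => [|r IH] e.
  by exists pred0 => [[]//|]; rewrite big_pred0_eq.
have [k ke ->] := max_windows_attained c a r e.
have [F FP ->] := IH (k - c.+1).
exists (fun i => (i < k - c.+1) && F i || (k - c.+1 <= i < k)).
  elim/last_ind=> [//|s x _]; rewrite /chain pairwise_rcons => /andP[sx ss].
  rewrite all_rcons => /andP[Fx Fs].
  have xk : x < k by move: Fx; lia.
  have sk y : y \in s -> y < k - c.+1 by move/(allP sx); lia.
  have [|ssize _] := FP s ss.
    by apply/allP => y ys; move/(allP Fs): (ys); have := sk y ys; lia.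
  rewrite size_rcons all_rcons; split; first by [].
  rewrite (leq_trans xk ke); apply/allP => y /sk; lia.
rewrite (@big_cat_nat _ _ _ (k - c.+1) 0 e) /=; [|lia|lia].
rewrite (@big_cat_nat _ _ _ k (k - c.+1) e) /=; [|lia|lia].
rewrite [X in _ = _ + (_ + X)]big_nat_cond [X in _ = _ + (_ + X)]big_pred0; last by move=> i /=; lia.
rewrite addn0 addnC; congr (_ + _).
  rewrite big_nat_cond [RHS]big_nat_cond; apply: eq_bigl => i; lia.
rewrite big_nat_cond [RHS]big_nat_cond; apply: eq_bigl => i; lia.
Qed.

(** Scanning upwards, an index of the support is added when it exceeds all chosen ones by more than
    [c]; a skipped one is thus covered by a chosen one. *)
Lemma greedy_chain c a e : exists s : seq nat,
  [/\ chain c s, all (fun i => 0 < a i) s, all (fun i => i < e) s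
    & forall i, i < e -> 0 < a i -> exists2 j, j \in s & j <= i <= j + c].
Proof.
elim: e => [|e [s [cs ps es covs]]]; first by exists [::].
have es1 : all (fun i => i < e.+1) s by apply: sub_all es => i; lia.
case/boolP: ((0 < a e) && all (fun i => i + c < e) s) => [/andP[ae se]|].
  exists (rcons s e); split.
  - by rewrite /chain pairwise_rcons se.
  - by rewrite all_rcons ae.
  - by rewrite all_rcons leqnn.
  move=> i; rewrite ltnS leq_eqVlt => /predU1P[-> _|ie /(covs i ie)[j js ji]].
    by exists e; rewrite ?mem_rcons ?mem_head ?leqnn ?leq_addr.
  by exists j; rewrite // mem_rcons inE js orbT.
move=> nse; exists s; split=> // i; rewrite ltnS leq_eqVlt => /predU1P[->|]; last exact: covs.
move=> ae; move: nse; rewrite ae /= => /allPn[j js je]; exists j => //.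
by have := allP es _ js; lia.
Qed.

Lemma sum_mem_seq e (s : seq nat) : uniq s -> all (fun i => i < e) s ->
  \sum_(0 <= i < e) (i \in s) = size s.
Proof.
move=> us es; rewrite -sum1_size (eq_bigr (fun i => if i \in s then 1 else 0)).
  rewrite -big_mkcond -big_filter; apply: perm_big; apply: uniq_perm => //.
    by rewrite filter_uniq ?iota_uniq.
  move=> i; rewrite mem_filter mem_index_iota /=.
  by case: (boolP (i \in s)) => [/(allP es)|].
by move=> i _; case: (i \in s).
Qed.

(** Induction on [s], removing the greedy chain [l]: the total weight drops by [size l] and the
    window maximum by at least [r], so the hypothesis survives with [s] lowered by [size l - r]. *)
Lemma chain_packing_max c r n a s : (forall i, n <= i -> a i = 0) ->
  max_windows c a r n + s <= \sum_(0 <= i < n) a i ->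
  exists P : seq (seq nat),
    [/\ all (fun l => [&& chain c l, r < size l & all (fun i => i < n) l]) P,
        \sum_(l <- P) (size l - r) = s
      & forall i, \sum_(l <- P) (i \in l) <= a i].
Proof.
elim/ltn_ind: s a => s IH a a0 mws.
have [->|s0] := posnP s.
  by exists [::]; split=> // [|i]; rewrite big_nil.
have [l [cl pl nl covl]] := greedy_chain c a n.
have {}covl i : 0 < a i -> exists2 j, j \in l & j <= i <= j + c.
  by case: (ltnP i n) => [/covl//|/a0 ->].
have ul := chain_uniq cl.
have cntl := sum_mem_seq ul nl.
have gapl i j : i \in l -> j \in l -> i < j -> i + c < j.
  rewrite -index_mem -[j \in l]index_mem => pl' ql' ij.
  have [pq|qp|pq] := ltngtP (index i l) (index j l).
  - by have := pairwiseP 0 cl _ _ pl' ql' pq; rewrite !nth_index -?index_mem.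
  - by have := pairwiseP 0 cl _ _ ql' pl' qp; rewrite !nth_index -?index_mem //; lia.
  - by move: ij; rewrite -(nth_index 0 (_ : i \in l)) -?index_mem // pq nth_index -?index_mem // ltnn.
have posl i : i \in l -> 0 < a i by move/(allP pl).
(* Otherwise [r] windows would carry the whole weight, against [0 < s]. *)
have sizel : r < size l.
  rewrite ltnNge; apply/negP => lr.
  rewrite (max_windows_cover (C := mem l)) ?cntl // in mws; by lia.
(* If [l] is long enough, its first [r + s] elements alone form the packing. *)
have [lrs|lrs] := leqP s (size l - r).
  exists [:: take (r + s) l]; rewrite /= !big_seq1 andbT.
  have szt : size (take (r + s) l) = r + s by rewrite size_takel //; lia.
  have stl : subseq (take (r + s) l) l by apply: take_subseq.
  split; rewrite ?szt.
  - rewrite [chain _ _](subseq_pairwise stl cl) /=; apply/andP; split; first by lia.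
    by apply/allP => i /(mem_subseq stl); apply: (allP nl).
  - lia.
  move=> i; rewrite big_seq1.
  by case: (boolP (i \in _)) => //= /(mem_subseq stl)/posl.
pose a' i := a i - (i \in l).
have suba : \sum_(0 <= i < n) a' i + size l = \sum_(0 <= i < n) a i.
  rewrite -cntl -big_split; apply: eq_bigr => i _; rewrite /a' /=.
  by case: (boolP (i \in l)) => /= [/posl|]; lia.
have mwa : max_windows c a' r n + r <= max_windows c a r n.
  by apply: (max_windows_subC (C := mem l)) => //; rewrite [leqRHS]cntl ltnW.
have [|||P [chP wP aP]] := IH (s - (size l - r)) _ a'.
- by lia.
- by move=> i /a0; rewrite /a' => ->.
- by lia.
exists (l :: P); split.
- by rewrite /= cl sizel nl.
- by rewrite big_cons wP; lia.
move=> i; rewrite big_cons; have := aP i; rewrite /a'.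
by case: (boolP (i \in l)) => /= [/posl|]; lia.
Qed.

(** The hypothesis is applied to the union of an optimal family of [r] windows, which has no chain
    longer than [r]. *)
Lemma chain_packing c r n a s : (forall i, n <= i -> a i = 0) ->
  (forall F : pred nat, (forall l, chain c l -> all F l -> size l <= r) ->
     s <= \sum_(0 <= i < n | ~~ F i) a i) ->
  exists P : seq (seq nat),
    [/\ all (fun l => [&& chain c l, r < size l & all (fun i => i < n) l]) P,
        \sum_(l <- P) (size l - r) = s
      & forall i, \sum_(l <- P) (i \in l) <= a i].
Proof.
move=> a0 sF; apply: chain_packing_max => //; have [F FP ->] := max_windows_set c a r n.
rewrite [leqRHS](bigID F) leq_add2l; apply: sF => l cl Fl.
by have [] := FP l cl Fl.
Qed.

Local Open Scope ring_scope.

(** * Leading monomials and translations *)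

Lemma mlead_eq (n : nat) (R : nzRingType) (p : {mpoly R[n]}) (m : 'X_{1..n}) :
  p@_m != 0 -> (forall b, p@_b != 0 -> (b <= m)%O) -> mlead p = m.
Proof.
move=> pm pmax; apply/eqP; rewrite eq_le msupp_le_mlead ?mcoeff_msupp // andbT.
apply: pmax; rewrite mleadc_eq0; apply: contraNneq pm => ->.
by rewrite mcoeff0.
Qed.

(** The range [N] does not depend on [e], so that a product of such sums distributes over one type
    of finite functions. *)
Lemma exprD_ord (R : comNzRingType) (x y : R) N e : (e < N)%N ->
  (x + y) ^+ e = \sum_(j < N) (x ^+ (e - j) * y ^+ j) *+ 'C(e, j).
Proof.
move=> eN; rewrite exprDn.
rewrite (big_ord_widen N (fun j => (x ^+ (e - j) * y ^+ j) *+ 'C(e, j))) //.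
rewrite big_mkcond; apply: eq_bigr => j _; case: ltnP => // ej.
by rewrite bin_small.
Qed.

Section Translation.
Variables (K : comNzRingType) (n k : nat) (w : 'I_n -> 'X_{1..k}).
Implicit Types (f : {mpoly K[n]}) (m a b : 'X_{1..n}) (e : 'X_{1..k}).

Definition weight m : 'X_{1..k} := (\sum_i w i *+ m i)%MM.

(** The coefficient at [e] of [f] after translating each [x_i] by the monomial of exponent [w i]: a
    sum of divided derivatives of orders [d] of weight [e]. All exponents in [f] are below
    [msize f]. *)
Definition taylor f e : {mpoly K[n]} :=
  \sum_(m <- msupp f)
    \sum_(d : {ffun 'I_n -> 'I_(msize f)} | weight [multinom d i | i < n] == e)
      (f@_m *+ \prod_i 'C(m i, d i)) *: 'X_[m - [multinom d i | i < n]].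

Lemma mnm_lt_msize f m i : m \in msupp f -> (m i < msize f)%N.
Proof.
move=> mf; apply: leq_ltn_trans (msize_mdeg_lt mf).
by rewrite mdegE (bigD1 i) //= leq_addr.
Qed.

Lemma mcoeff_taylor f e b : (taylor f e)@_b =
  \sum_(m <- msupp f)
    \sum_(d : {ffun 'I_n -> 'I_(msize f)} | weight [multinom d i | i < n] == e)
      (f@_m *+ \prod_i 'C(m i, d i)) * ((m - [multinom d i | i < n])%MM == b)%:R.
Proof.
rewrite /taylor !raddf_sum; apply: eq_bigr => m _.
rewrite /= raddf_sum; apply: eq_bigr => d _.
by rewrite /= mcoeffZ mcoeffX.
Qed.

(** The binomial coefficients vanish unless [a] divides [m], so the truncated subtraction is exact
    in every non-zero term. *)
Lemma taylor_term (m a b : 'X_{1..n}) (x : K) :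
  (x *+ \prod_i 'C(m i, a i)) * ((m - a)%MM == b)%:R != 0 -> (b + a = m)%MM.
Proof.
case: (_ =P b) => [<-|_]; last by rewrite mulr0 eqxx.
rewrite mulr1 => nz; apply: submK; apply/mnm_lepP => i.
rewrite leqNgt; apply/negP => lt.
by move: nz; rewrite (bigD1 i) //= bin_small // mul0n mulr0n eqxx.
Qed.

(* The coefficient at [weight m2] collects the divided derivatives of [f] of
   all orders [a] with [weight a = weight m2]; the order [m2] is the least of
   these, and the binomial coefficients are 1 because [m1] and [m2] have
   disjoint supports. *)
Lemma mlead_taylor f (m1 m2 : 'X_{1..n}) :
  f != 0 -> mlead f = (m1 + m2)%MM -> (forall i, m1 i = 0%N \/ m2 i = 0%N) ->
  (forall a, weight a = weight m2 -> (m2 <= a)%O) ->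
  taylor f (weight m2) != 0 /\ mlead (taylor f (weight m2)) = m1.
Proof.
move=> f0 lf disj minW; set g := taylor f _.
have taylorT m (d : {ffun 'I_n -> 'I_(msize f)}) b :
    (f@_m *+ \prod_i 'C(m i, d i)) * ((m - [multinom d i | i < n])%MM == b)%:R
      != 0 -> (b + [multinom d i | i < n] = m)%MM.
  by move=> nz; apply: (@taylor_term _ _ _ f@_m); under eq_bigr do rewrite mnmE.
(* A contributing order [d] satisfies [m2 <= d], so [b > m1] would give a monomial [b + d] of [f]
   above its leading one. *)
have gmax b : g@_b != 0 -> (b <= m1)%O.
  rewrite leNgt; apply: contraNN => m1b; rewrite mcoeff_taylor.
  rewrite big1_seq ?eqxx // => m /= mf; rewrite big1 // => d /eqP/minW m2d.
  apply/eqP; apply: contraT => /taylorT E.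
  have := msupp_le_mlead mf; rewrite lf leNgt -E.
  by rewrite (ltmc_le_add m1b m2d).
suff gm1 : g@_m1 = mleadc f.
  have g1 : g@_m1 != 0 by rewrite gm1 mleadc_eq0.
  split; last exact: mlead_eq.
  by apply: contraNneq g1 => ->; rewrite mcoeff0.
have lfs : (m1 + m2)%MM \in msupp f by rewrite -lf mlead_supp.
have m2lt i : (m2 i < msize f)%N.
  by apply: leq_ltn_trans (mnm_lt_msize i lfs); rewrite mnmDE leq_addl.
pose d2 := [ffun i => Ordinal (m2lt i)].
have d2E : [multinom d2 i | i < n] = m2.
  by apply/mnmP => i; rewrite mnmE ffunE.
rewrite mcoeff_taylor (bigD1_seq _ lfs (msupp_uniq f)) /=.
rewrite (bigD1 d2) /=; last by rewrite d2E.
rewrite d2E addmK eqxx mulr1 [X in _ + X + _]big1 ?addr0; last first.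
  move=> d /andP[/eqP/minW m2d dd2].
  apply/eqP; apply: contraT => /taylorT E.
  move/addmI: E => E.
  case/eqP: dd2; apply/ffunP => i; apply/val_inj; rewrite ffunE /=.
  by rewrite -E mnmE.
rewrite [X in _ + X]big1_seq ?addr0; last first.
  move=> m /= /andP[mm mf]; rewrite big1 // => d /eqP/minW m2d.
  apply/eqP; apply: contraT => /taylorT E.
  have := msupp_le_mlead mf; rewrite lf.
  rewrite -E lemc_add2r => dm2.
  by case/eqP: mm; rewrite -E; congr (_ + _)%MM; apply: le_anti; rewrite dm2.
rewrite lf big1 ?mulr1n // => i _; rewrite mnmDE ffunE /=.
by have [->|->] := disj i; rewrite ?add0n ?binn ?bin0.
Qed.

Variables (D : comNzRingType) (phi : {rmorphism {mpoly K[n]} -> D}).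

Definition translate : {mpoly K[n]} -> {mpoly D[k]} :=
  mmap (@mpolyC k D \o phi \o @mpolyC n K) (fun i => (phi 'X_i)%:MP + 'X_[w i]).
HB.instance Definition _ := GRing.RMorphism.on translate.

Lemma translateX i : translate 'X_i = (phi 'X_i)%:MP + 'X_[w i].
Proof. by rewrite /translate mmapX mmap1U. Qed.

Lemma translate_coeff f e : (translate f)@_e = phi (taylor f e).
Proof.
rewrite /translate /mmap /taylor !raddf_sum /= big_seq [RHS]big_seq.
apply: eq_bigr => m mf; rewrite mcoeffCM /mmap1.
rewrite (eq_bigr _ (fun i _ => exprD_ord _ _ (mnm_lt_msize i mf))).
rewrite bigA_distr_bigA /= !raddf_sum /= mulr_sumr [RHS]big_mkcond.
apply: eq_bigr => d _ /=.
rewrite prodrMn big_split /= mprodXnE.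
have -> : \prod_(i < n) (phi 'X_i)%:MP_[k] ^+ (m i - d i)
    = (phi 'X_[m - [multinom d i | i < n]])%:MP.
  rewrite mpolyXE_id !rmorph_prod; apply: eq_bigr => i _ /=.
  by rewrite !rmorphXn mnmBE mnmE.
rewrite mcoeffMn mcoeffCM mcoeffX.
have -> : (\sum_(i < n) w i *+ d i)%MM = weight [multinom d i | i < n].
  by apply: eq_bigr => i _; rewrite mnmE.
case: eqP => _; last by rewrite mulr0 mul0rn mulr0.
by rewrite mulr1 -mul_mpolyC rmorphM /= mpolyCMn rmorphMn /= mulrnAr mulrnAl.
Qed.
End Translation.

(** * Generic points of the rational scroll *)

Section ScrollWeights.
Variables (n c : nat).
Hypothesis c_gt0 : (0 < c)%N.

(** The exponent of [lambda_(j mod c) u^(j / c)]: the first [c] variables are the [lambda_p], the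
    last one is [u]. *)
Definition scroll_weight (j : 'I_n) : 'X_{1..c.+1} :=
  (U_(inord (j %% c)) + U_(ord_max) *+ (j %/ c))%MM.

Lemma scroll_weight_max j : scroll_weight j ord_max = (j %/ c)%N.
Proof.
rewrite mnmDE mulmnE !mnm1E eqxx mul1n.
have jc : (j %% c < c)%N by rewrite ltn_mod.
by rewrite -val_eqE /= inordK ?(ltn_eqF jc) // ltnW.
Qed.

Lemma scroll_weight_lt j (p : 'I_c) :
  scroll_weight j (widen_ord (leqnSn c) p) = (j %% c == p)%N.
Proof.
rewrite mnmDE mulmnE !mnm1E -!val_eqE /=.
by rewrite inordK ?(gtn_eqF (ltn_ord p)) ?mul0n ?addn0 // ltnS ltnW // ltn_mod.
Qed.

(** The exponent of [lambda_p] in the weight is the degree of [a] in the variables of residue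
    [p]. *)
Lemma sum_scroll_weight (g : nat -> nat) (a : 'X_{1..n}) :
  (\sum_i a i * g (i %% c) =
   \sum_(p < c) g p * weight scroll_weight a (widen_ord (leqnSn c) p))%N.
Proof.
under [RHS]eq_bigr => p _ do rewrite mnm_sumE big_distrr /=.
rewrite exchange_big; apply: eq_bigr => i _.
rewrite (bigD1 (Ordinal (ltn_pmod i c_gt0))) //= big1.
  by rewrite mulmnE scroll_weight_lt /= eqxx mul1n addn0 mulnC.
move=> p; rewrite -val_eqE /= eq_sym => /negbTE ne.
by rewrite mulmnE scroll_weight_lt ne mul0n muln0.
Qed.

Lemma weight_max (a : 'X_{1..n}) :
  weight scroll_weight a ord_max = (\sum_i a i * (i %/ c))%N.
Proof.
by rewrite mnm_sumE; apply: eq_bigr => i _; rewrite mulmnE scroll_weight_max mulnC.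
Qed.

(* [v p] is the least quotient [i %/ c] among the indices [i > k] of residue
   [p]; the window ]k, k + c] consists of the indices attaining it. *)
Lemma scroll_weight_min (a b : 'X_{1..n}) :
  weight scroll_weight a = weight scroll_weight b ->
  (forall i j, (0 < b i)%N -> (0 < b j)%N -> (j <= i + c)%N) -> (b <= a)%O.
Proof.
move=> ab win; rewrite leNgt; apply/negP => lt_ab.
have dab : mdeg a = mdeg b.
  have deg x : mdeg x = (\sum_(i < n) x i * 1)%N.
    by rewrite mdegE; apply: eq_bigr => i _; rewrite muln1.
  by rewrite !deg !(sum_scroll_weight (fun=> 1%N)) ab.
have [k eq_ab lt_abk] := ltmcP dab lt_ab.
pose v p := (k %/ c + (p <= k %% c))%N.
have := sum_scroll_weight v a; rewrite ab -sum_scroll_weight => vE.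
have := weight_max a; rewrite ab weight_max => qE.
(* This says that [(a i - b i) * (i %/ c - v (i %% c))] is non-negative over the integers: it is 0
   for [i < k] and for [k < i <= k + c], beyond that [b i = 0], and at [k] both factors are
   negative. The strict sum contradicts [vE] and [qE]. *)
have le_v (i : 'I_n) :
    (b i * (i %/ c) + a i * v (i %% c) <= a i * (i %/ c) + b i * v (i %% c))%N.
  have [ik|ki|/val_inj->] := ltngtP i k; first by rewrite eq_ab.
  - have [ei ek] := (divn_eq i c, divn_eq k c).
    have [li lk] := (ltn_pmod i c_gt0, ltn_pmod k c_gt0).
    have vi : (v (i %% c) <= i %/ c)%N.
      rewrite leqNgt; apply/negP; rewrite /v => lt.
      have := leq_mul2r c (i %/ c) (k %/ c).
      have := leq_mul2r c (i %/ c).+1 (k %/ c).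
      case: (leqP (i %% c) (k %% c)) lt => /=; nia.
    have [ikc|kci] := leqP i (k + c).
      suff vE' : (v (i %% c) = i %/ c)%N by rewrite vE' addnC.
      apply/eqP; rewrite eqn_leq vi /= /v leqNgt; apply/negP => lt.
      case: (leqP (i %% c) (k %% c)) lt => /=; nia.
    suff -> : b i = 0%N by rewrite add0n mul0n addn0 leq_mul2l vi orbT.
    apply/eqP; rewrite -leqn0 leqNgt; apply/negP => bi.
    have := win k i _ bi; lia.
  - by rewrite /v leqnn; nia.
have : (\sum_(i < n) (b i * (i %/ c) + a i * v (i %% c)) <
        \sum_(i < n) (a i * (i %/ c) + b i * v (i %% c)))%N.
  rewrite (bigD1 k) //= [ltnRHS](bigD1 k) //= -addSn leq_add //.
    by rewrite /v leqnn; nia.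
  by apply: leq_sum => i _.
by rewrite !big_split /= vE qE ltnn.
Qed.
End ScrollWeights.

Lemma nth_mnm n (m : 'X_{1..n}) x (xn : (x < n)%N) : nth 0%N m x = m (Ordinal xn).
Proof. by rewrite (mnm_nth 0%N). Qed.

Lemma nth_mnm_default n (m : 'X_{1..n}) x : (n <= x)%N -> nth 0%N m x = 0%N.
Proof. by move=> nx; rewrite nth_default ?size_tuple. Qed.

Definition chain_bound (c r n : nat) (m : 'X_{1..n}) : Prop :=
  forall s, chain c s -> all (fun i => 0 < nth 0 m i)%N s -> (size s <= r)%N.

(** [m2] is the part of [m] in the window starting at its least variable, and that variable extends
    every chain of [m1]. *)
Lemma chain_bound_split c r n (m : 'X_{1..n}) : chain_bound c r.+1 m ->
  exists m1 m2 : 'X_{1..n},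
    [/\ m = (m1 + m2)%MM, forall i, m1 i = 0%N \/ m2 i = 0%N, chain_bound c r m1
      & forall i j, (0 < m2 i)%N -> (0 < m2 j)%N -> (j <= i + c)%N].
Proof.
move=> mr; case: (pickP (fun i => 0 < m i)%N) => [i mi|m0]; last first.
  have {}m0 i : m i = 0%N by have := m0 i; lia.
  exists 0%MM, m; split.
  - by rewrite add0m.
  - by left; rewrite mnm0E.
  - move=> [//|x s] _ /allP/(_ x (mem_head x s)); case: (ltnP x n) => xn.
      by rewrite nth_mnm mnm0E.
    by rewrite nth_mnm_default.
  - by move=> i j; rewrite m0.
have {i mi}[i mi min_i] := @arg_minnP _ i (fun i => 0 < m i)%N val mi.
exists [multinom if (i + c < j)%N then m j else 0%N | j < n],
  [multinom if (i + c < j)%N then 0%N else m j | j < n]; split.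
- by apply/mnmP => j; rewrite mnmDE !mnmE; case: ifP; rewrite ?addn0.
- by move=> j; rewrite !mnmE; case: ifP; [right | left].
- move=> s cs ms; have := mr (val i :: s); rewrite /chain /= -/(chain c s) cs andbT.
  rewrite -mnm_nth mi /=.
  have ms' x : x \in s -> (i + c < x)%N && (0 < nth 0 m x)%N.
    move/(allP ms); case: (ltnP x n) => xn; last first.
      by rewrite nth_mnm_default.
    by rewrite !nth_mnm mnmE; case: ifP.
  by apply; apply/allP => x /ms'/andP[].
- move=> j1 j2; rewrite !mnmE; case: (ltnP (i + c) j1) => // j1c mj1; case: (ltnP (i + c) j2) => // j2c _.
  by rewrite (leq_trans j2c) // leq_add2r min_i.
Qed.

Lemma secant_morphism (K : idomainType) (n c r : nat) : (0 < c)%N ->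
  exists (D : idomainType) (phi : {rmorphism {mpoly K[n]} -> D})
         (u : 'I_r -> D) (v : 'I_r -> nat -> D),
    (forall i j (h : (j + i * c < n)%N),
       phi 'X_(Ordinal h) = \sum_l u l ^+ i * v l j) /\
    (forall f, f != 0 -> chain_bound c r (mlead f) -> phi f != 0).
Proof.
move=> c0; elim: r => [|r [D [phi [u [v [phiX phi0]]]]]].
  (* For [r = 0] the morphism takes the constant term. *)
  exists K, (@mcoeff n K 0%MM), (fun=> 0), (fun _ _ => 0); split.
    by move=> i j h; rewrite big_ord0 /= mcoeffX mnm1_eq0.
  move=> f f0 fr; suff lf : mlead f = 0%MM by rewrite /= -lf mleadc_eq0.
  apply/mnmP => i; rewrite mnm0E; apply/eqP; rewrite -leqn0 leqNgt.
  apply/negP => mi; have := fr [:: val i]; rewrite /= -mnm_nth mi.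
  by move=> /(_ isT isT).
pose w := @scroll_weight n c.
exists {mpoly D[c.+1]}, (translate w phi).
(* The new point has index [ord0] and the new variables as parameters; the old points become
   constants. *)
exists (fun l => oapp (fun l => (u l)%:MP) 'X_ord_max (unlift ord0 l)).
exists (fun l j => oapp (fun l => (v l j)%:MP)
  ('X_(inord (j %% c)) * 'X_ord_max ^+ (j %/ c)) (unlift ord0 l)).
split.
  move=> i j h; rewrite /= translateX phiX big_ord_recl unlift_none /= addrC.
  congr (_ + _).
    by rewrite /w /scroll_weight /= mpolyXD -mpolyXn addnC modnMDl divnMDl // exprD mulrCA.
  rewrite raddf_sum; apply: eq_bigr => l _ /=.
  by rewrite liftK /= rmorphM rmorphXn.
move=> f f0 /chain_bound_split[m1 [m2 [lf disj m1r win]]].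
have minW a : weight w a = weight w m2 -> (m2 <= a)%O.
  by move=> wa; apply: scroll_weight_min wa win.
(* The coefficient of the translate at the weight of [m2] is the image under the old [phi] of a
   polynomial with leading monomial [m1]. *)
have [t0 tl] := mlead_taylor f0 lf disj minW.
have : (translate w phi f)@_(weight w m2) != 0.
  by rewrite translate_coeff phi0 // tl.
by apply: contraNneq => ->; rewrite mcoeff0.
Qed.

(** * Minors and ideals *)

(** Variables of lower index are larger. If [i0] is the first row moved by [s], its term agrees with
    the diagonal one on earlier rows and afterwards uses only variables of index above
    [idx i0 i0]. *)
Lemma mlead_det (K : comNzRingType) (n c p : nat) (f g : 'I_p -> nat)
    (idx : 'I_p -> 'I_p -> 'I_n) (A : 'M[{mpoly K[n]}]_p) : (0 < c)%N ->
  (forall i j, A i j = 'X_(idx i j)) ->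
  (forall i j, idx i j = (g j + f i * c)%N :> nat) ->
  {homo f : i j / (i < j)%N} -> {homo g : i j / (i < j)%N} ->
  \det A != 0 /\ mlead (\det A) = (\sum_i U_(idx i i))%MM.
Proof.
move=> c0 AE idxE f_incr g_incr.
have g_le (i j : 'I_p) : (i <= j)%N -> (g i <= g j)%N.
  by rewrite leq_eqVlt => /predU1P[/val_inj->//|/g_incr/ltnW].
have f_le (i j : 'I_p) : (i <= j)%N -> (f i <= f j)%N.
  by rewrite leq_eqVlt => /predU1P[/val_inj->//|/f_incr/ltnW].
pose M (s : 'S_p) : 'X_{1..n} := (\sum_i U_(idx i (s i)))%MM.
have M_lt s : s != 1%g -> (M s < M 1%g)%O.
  move=> s1; have [i0 si0] : exists i : 'I_p, s i != i.
    apply/existsP; apply: contraNT s1; rewrite negb_exists => /forallP si.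
    by apply/eqP/permP => i; rewrite perm1; apply/eqP/negbNE/si.
  have {i0 si0}[i0 si0 min0] := @arg_minnP _ i0 (fun i : 'I_p => s i != i) val si0.
  have fix_s (i : 'I_p) : (i < i0)%N -> s i = i.
    by move=> ii0; apply/eqP; apply: contraTT ii0 => /min0; rewrite -leqNgt.
  have ge_s (i : 'I_p) : (i0 <= i)%N -> (i0 <= s i)%N.
    move=> i0i; rewrite leqNgt; apply/negP => lt.
    by have /perm_inj si := fix_s _ lt; rewrite si ltnNge i0i in lt.
  have idx_gt (i : 'I_p) : (i0 <= i)%N -> (idx i0 i0 < idx i (s i))%N.
    move=> i0i; rewrite !idxE; move: (i0i); rewrite leq_eqVlt => /predU1P[/val_inj<-|lt].
      rewrite ltn_add2r g_incr // ltn_neqAle ge_s // andbT.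
      by rewrite eq_sym; exact: si0.
    by rewrite -addnS leq_add ?g_le ?ge_s // ltn_mul2r c0 f_incr.
  have idx_ge (i : 'I_p) : (i0 <= i)%N -> (idx i0 i0 <= idx i i)%N.
    by move=> i0i; rewrite !idxE leq_add ?g_le // leq_mul2r f_le ?orbT.
  apply/ltmcP; first by rewrite !mdeg_sum; apply: eq_bigr => i _; rewrite !mdeg1.
  exists (idx i0 i0) => [j lt|/=].
    rewrite !mnm_sumE; apply: eq_bigr => i _; rewrite perm1 !mnm1E.
    have [/fix_s->//|i0i] := ltnP i i0.
    by rewrite -!val_eqE /= !gtn_eqF // (leq_trans lt) ?idx_ge // ltnW ?idx_gt.
  rewrite !mnm_sumE (bigD1 i0) //= [ltnRHS](bigD1 i0) //= perm1 !mnm1E eqxx.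
  rewrite -val_eqE /= gtn_eqF ?idx_gt // add0n add1n ltnS.
  apply: leq_sum => i _; rewrite perm1 !mnm1E.
  have [/fix_s->//|i0i] := ltnP i i0.
  by rewrite -val_eqE /= gtn_eqF ?idx_gt.
have detE : \det A = \sum_(s : 'S_p) (-1) ^+ s *: 'X_[M s].
  apply: eq_bigr => s _; rewrite -mprodXE -mul_mpolyC rmorphXn /= mpolyCN mpolyC1.
  by congr (_ * _); apply: eq_bigr => i _; rewrite AE.
have coefE b : (\det A)@_b = \sum_(s : 'S_p) (-1) ^+ s * (M s == b)%:R.
  by rewrite detE raddf_sum; apply: eq_bigr => s _; rewrite /= mcoeffZ mcoeffX.
have coef1 : (\det A)@_(M 1%g) = 1.
  rewrite coefE (bigD1 1%g) //= eqxx odd_perm1 expr0 mulr1 big1 ?addr0 // => s /M_lt.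
  by move=> /lt_eqF->; rewrite mulr0.
have ME : M 1%g = (\sum_i U_(idx i i))%MM by apply: eq_bigr => i _; rewrite perm1.
rewrite -ME; split.
  by apply/eqP => d0; move: coef1; rewrite d0 mcoeff0 => /eqP; rewrite eq_sym oner_eq0.
apply: mlead_eq => [|b]; first by rewrite coef1 oner_neq0.
rewrite coefE leNgt; apply: contraNN => bM; rewrite big1 // => s _.
suff /negbTE-> : M s != b by rewrite mulr0.
apply: contraTneq bM => <-; rewrite -leNgt.
by have [->|/M_lt/ltW] := eqVneq s 1%g.
Qed.

Lemma chain_nth c s i d : chain c s -> (i + d < size s)%N ->
  (nth 0 s i + d * c.+1 <= nth 0 s (i + d))%N.
Proof.
move=> cs; elim: d => [|d IH] lt; first by rewrite mul0n !addn0.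
rewrite addnS in lt *; have := IH (ltnW lt).
have := pairwiseP 0%N cs (i + d)%N (i + d).+1 (ltnW lt) lt (ltnSn _).
rewrite mulSn; lia.
Qed.

(** All rows and the columns [nth 0 s j - j * c] are taken, which puts the variables of [s] on the
    diagonal; the gaps of the chain make these columns increase. *)
Lemma chain_minor (K : fieldType) (n c t : nat) (s : seq nat) : (0 < c)%N ->
  chain c s -> all (fun i => i < n)%N s -> size s = t ->
  exists g : {mpoly K[n]}, [/\ is_minor t (ext_hankel K n c t) g, g != 0
    & forall i, nth 0%N (mlead g) i = (i \in s)].
Proof.
move=> c0 cs sn st; pose g (j : 'I_t) := (nth 0 s j - j * c)%N.
have ge_s (j : 'I_t) : (j * c <= nth 0 s j)%N.
  have := @chain_nth c s 0 j cs; rewrite add0n st ltn_ord; lia.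
have g_incr : {homo g : i j / (i < j)%N}.
  move=> i j ij; have := @chain_nth c s i (j - i) cs.
  rewrite (subnKC (ltnW ij)) st ltn_ord => /(_ isT).
  have := ge_s i; have := ge_s j; rewrite /g; nia.
have g_lt (j : 'I_t) : (g j < n - t.-1 * c)%N.
  have jt := ltn_ord j.
  have [d tE] : exists d, (t.-1 = j + d)%N by exists (t.-1 - j)%N; lia.
  have t1 : (j + d < size s)%N by lia.
  have /= := allP sn _ (mem_nth 0%N t1); have := chain_nth cs t1; have := ge_s j.
  rewrite /g tE mulnDl mulnS; lia.
pose g' j := Ordinal (g_lt j).
have [|||] := @mlead_det K n c t val g (fun i j => hankel_index i (g' j))
  (mxsub id g' (ext_hankel K n c t)) c0 _ _ _ g_incr.
  - by move=> i j; rewrite !mxE.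
  - by [].
  - by [].
move=> d0 dl; exists (\det (mxsub id g' (ext_hankel K n c t))); split=> //.
  by exists id, g'; split.
move=> i; rewrite dl.
have idxE (j : 'I_t) : val (hankel_index j (g' j)) = nth 0%N s j.
  by rewrite /= subnK.
case: (ltnP i n) => [ni|ni]; last first.
  by rewrite nth_mnm_default //; case: (boolP (i \in s)) => // /(allP sn); lia.
rewrite nth_mnm mnm_sumE; case: (boolP (i \in s)) => [si|si].
  have it : (index i s < t)%N by rewrite -st index_mem.
  rewrite (bigD1 (Ordinal it)) //= mnm1E -val_eqE idxE /= nth_index // eqxx.
  rewrite big1 // => j ne; rewrite mnm1E -val_eqE idxE /=.
  case: eqP => // E; case/eqP: ne; apply/val_inj => /=.
  by rewrite -E index_uniq ?st ?(chain_uniq cs).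
rewrite big1 // => j _; rewrite mnm1E -val_eqE idxE /=.
by case: eqP => // E; case/negP: si; rewrite -E mem_nth ?st.
Qed.

(** * Ideals, division and determinants *)

Section IdealTheory.
Variable R : comNzRingType.
Implicit Types (S I J : R -> Prop) (x y : R).

Definition is_ideal J : Prop :=
  [/\ J 0, forall x y, J x -> J y -> J (x + y) & forall a x, J x -> J (a * x)].

Lemma ideal_sum_closed J (T : Type) (r : seq T) (F : T -> R) :
  is_ideal J -> (forall i, J (F i)) -> J (\sum_(i <- r) F i).
Proof. by case=> J0 JD _ JF; elim/big_ind: _. Qed.

Lemma ideal_gen_sub S x : S x -> ideal_gen S x.
Proof.
by move=> Sx; exists 1%N, (fun=> 1), (fun=> x); rewrite big_ord1 mul1r.
Qed.

Lemma ideal_gen_ideal S : is_ideal (ideal_gen S).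
Proof.
split.
- by exists 0%N, (fun=> 0), (fun=> 0); split=> [[]//|]; rewrite big_ord0.
- move=> x y [k [a [g [gS ->]]]] [l [b [h [hS ->]]]].
  pose glue (u : 'I_k -> R) v (i : 'I_(k + l)) :=
    match split i with inl i => u i | inr i => v i end.
  exists (k + l)%N, (glue a b), (glue g h); split.
    by move=> i; rewrite /glue; case: (split i).
  rewrite big_split_ord /glue; congr (_ + _); apply: eq_bigr => i _.
    by rewrite -[lshift l i]/(unsplit (inl i)) unsplitK.
  by rewrite -[rshift k i]/(unsplit (inr i)) unsplitK.
- move=> b x [k [a [g [gS ->]]]]; exists k, (fun i => b * a i), g; split=> //.
  by rewrite mulr_sumr; apply: eq_bigr => i _; rewrite mulrA.
Qed.

Lemma ideal_gen_min S J : is_ideal J -> (forall x, S x -> J x) ->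
  forall x, ideal_gen S x -> J x.
Proof.
move=> idJ SJ x [k [a [g [gS ->]]]]; apply: ideal_sum_closed => // i.
by case: idJ => _ _; apply; apply: SJ.
Qed.

Lemma ideal_mul_sub I J x y : I x -> J y -> ideal_mul I J (x * y).
Proof. by move=> Ix Jy; apply: ideal_gen_sub; exists x, y. Qed.

Lemma ideal_exp_ideal I s : is_ideal (ideal_exp I s).
Proof. by case: s => [//|s]; apply: ideal_gen_ideal. Qed.

Lemma ideal_expM I s1 s2 x y :
  ideal_exp I s1 x -> ideal_exp I s2 y -> ideal_exp I (s1 + s2) (x * y).
Proof.
elim: s1 x => [|s1 IH] x; first by move=> _ Iy; case: (ideal_exp_ideal I s2) => _ _; apply.
move=> I1 I2; pose J z := ideal_exp I (s1 + s2).+1 (z * y).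
have [e0 eD eM] := ideal_exp_ideal I (s1 + s2).+1.
apply: (@ideal_gen_min _ J) I1; rewrite /J.
  split; first by rewrite mul0r.
  - by move=> u v; rewrite mulrDl; apply: eD.
  - by move=> a u; rewrite -mulrA; apply: eM.
move=> _ [u [v [Iu Iv ->]]]; rewrite -mulrA; apply: ideal_mul_sub => //.
exact: IH.
Qed.

Lemma ideal_exp_prod I (k : nat) (F : 'I_k -> R) :
  (forall i, I (F i)) -> ideal_exp I k (\prod_i F i).
Proof.
elim: k F => [//|k IH] F IF; rewrite big_ord_recl; apply: ideal_mul_sub => //.
by apply: IH.
Qed.

Lemma ideal_exp_det I k (A : 'M[R]_k) :
  (forall i j, I (A i j)) -> ideal_exp I k (\det A).
Proof.
move=> IA; have idI := ideal_exp_ideal I k.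
apply: ideal_sum_closed => // s; have [_ _] := idI; apply.
exact: ideal_exp_prod.
Qed.

End IdealTheory.

(** Division algorithm: subtracting the multiple [h] of [g] with the leading term of [f] stays in
    [P] and lowers the leading monomial. *)
Lemma lead_reduction (K : fieldType) (n : nat) (P J : {mpoly K[n]} -> Prop) :
  is_ideal J -> (forall f g, P f -> J g -> P (f - g)) ->
  (forall f, P f -> f != 0 ->
     exists g, [/\ J g, g != 0 & (mlead g <= mlead f)%MM]) ->
  forall f, P f -> J f.
Proof.
move=> [J0 JD JM] PB PJ; elim/mleadrect => f IH Pf.
have [->//|f0] := eqVneq f 0; have [g [Jg g0 gf]] := PJ f Pf f0.
pose h := (mleadc f / mleadc g) *: 'X_[mlead f - mlead g] * g.
have q0 : mleadc f / mleadc g != 0 by rewrite mulf_neq0 ?invr_neq0 ?mleadc_eq0.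
have X0 : 'X_[mlead f - mlead g] != 0 :> {mpoly K[n]}.
  by rewrite -msupp_eq0 msuppX.
have hl : mlead h = mlead f.
  by rewrite mleadM ?mscalerI ?negb_or ?q0 // mleadZ // mleadXm submK.
have Jh : J h by apply: JM.
have [fh|fh] := eqVneq (f - h) 0; first by rewrite (subr0_eq fh).
rewrite -(subrK h f) ; apply: JD => //; apply: IH; last exact: PB.
rewrite lt_neqAle; apply/andP; split; last first.
  by apply: le_trans (mleadB_le _ _) _; rewrite hl joinxx.
apply: contraNneq fh => lE; rewrite -mleadc_eq0 lE mcoeffB -{2}hl.
rewrite /h mleadM ?mscalerI ?negb_or ?q0 // mleadcM mleadcZE mleadXm mcoeffX eqxx.
by rewrite mulr1 divfK ?mleadc_eq0 // subrr.
Qed.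

Lemma det_mulmx_small (D : comNzRingType) (k r : nat) (B : 'M[D]_(k, r))
    (C : 'M[D]_(r, k)) : (r < k)%N -> \det (B *m C) = 0.
Proof.
(* Padding with zeros makes both factors square, the first one with a zero column. *)
move=> rk; have [d kE] : exists d, k = (r + d.+1)%N by exists (k - r.+1)%N; lia.
subst k; have -> : B *m C = row_mx B 0 *m col_mx C (0 : 'M_(d.+1, _)).
  by rewrite mul_row_col mul0mx addr0.
rewrite det_mulmx (expand_det_col _ (rshift r ord0)) big1 ?mul0r // => i _.
by rewrite row_mxEr mxE mul0r.
Qed.

Lemma chain_bound_mdeg c r n (m : 'X_{1..n}) : (mdeg m <= r)%N -> chain_bound c r m.
Proof.
move=> mr s cs ms; apply: leq_trans mr.
have sn : all (fun i => i < n)%N s.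
  apply/allP => i /(allP ms); case: (ltnP i n) => // ni.
  by rewrite nth_mnm_default.
rewrite -(sum_mem_seq (chain_uniq cs) sn) big_mkord mdegE.
apply: leq_sum => i _; case: (boolP (_ \in s)) => // /(allP ms).
by rewrite -mnm_nth.
Qed.

(** Schur complement without denominators: multiplying on the left by [L] makes the matrix block
    upper triangular. *)
Lemma schur_det (R : comNzRingType) (r d : nat) (A : 'M[R]_r) (B : 'M_(r, d))
    (C : 'M_(d, r)) (E : 'M_d) :
  \det A ^+ d * \det (block_mx A B C E) =
    \det A * \det (\det A *: E - C *m \adj A *m B).
Proof.
pose L : 'M_(r + d) := block_mx 1%:M 0 (- (C *m \adj A)) (\det A)%:M.
have -> : \det A ^+ d = \det L by rewrite det_lblock det1 mul1r det_scalar.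
rewrite -det_mulmx mulmx_block !mul1mx !mul0mx !addr0 !mul_scalar_mx !mulNmx.
rewrite -[C *m _ *m A]mulmxA mul_adj_mx mul_mx_scalar addNr det_ublock.
by rewrite addrC.
Qed.

(** * The ideals of minors as kernels *)

Section SecantIdeal.
Variables (K : fieldType) (n c r : nat).
Hypothesis c_gt0 : (0 < c)%N.
Variables (D : idomainType) (phi : {rmorphism {mpoly K[n]} -> D}).
Variables (u : 'I_r -> D) (v : 'I_r -> nat -> D).
Hypothesis phiX : forall i j (h : (j + i * c < n)%N),
  phi 'X_(Ordinal h) = \sum_l u l ^+ i * v l j.
Hypothesis phi_neq0 : forall f, f != 0 -> chain_bound c r (mlead f) -> phi f != 0.

Let I := hankel_ideal K n c r.+1.

(** By [phiX] the image of the matrix factors through rank [r]. *)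
Lemma phi_minor t k (f : 'I_k -> 'I_t) (g : 'I_k -> 'I_(n - t.-1 * c)) :
  (r < k)%N -> phi (\det (mxsub f g (ext_hankel K n c t))) = 0.
Proof.
move=> rk; rewrite -det_map_mx.
rewrite -(det_mulmx_small (\matrix_(i, l) u l ^+ f i) (\matrix_(l, j) v l (g j)) rk).
congr (\det _); apply/matrixP => i j; rewrite !mxE phiX.
by apply: eq_bigr => l _; rewrite !mxE.
Qed.

Lemma hankel_ideal_ker x : I x -> phi x = 0.
Proof.
apply: (@ideal_gen_min _ _ (fun x => phi x = 0)) => [|_ [f [g [_ _ ->]]]].
  split=> [|y z y0 z0|a y y0]; first exact: rmorph0.
    by rewrite rmorphD y0 z0 addr0.
  by rewrite rmorphM y0 mulr0.
exact: phi_minor.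
Qed.

(** By [phi_neq0] the leading monomial of a non-zero element of the kernel contains a chain of
    length [r + 1], so the leading monomial of a minor divides it. *)
Lemma hankel_idealE x : I x <-> phi x = 0.
Proof.
split; first exact: hankel_ideal_ker.
apply: (@lead_reduction _ _ (fun x => phi x = 0)).
- exact: ideal_gen_ideal.
- by move=> f g f0 /hankel_ideal_ker g0; rewrite rmorphB f0 g0 subr0.
move=> f pf f0; apply: NNPP => nog.
have := phi_neq0 f0; rewrite pf eqxx => ncb; apply: notF; apply: ncb.
move=> s cs ms; rewrite leqNgt; apply/negP => rs; apply: nog.
have cs' : chain c (take r.+1 s) by apply: subseq_pairwise cs; apply: take_subseq.
have sn : all (fun i => i < n)%N (take r.+1 s).
  apply/allP => i /mem_take/(allP ms); case: (ltnP i n) => // ni.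
  by rewrite nth_mnm_default.
have [g [gm g0 gl]] := chain_minor K c_gt0 cs' sn (size_takel rs).
exists g; split=> //; first exact: ideal_gen_sub.
apply/mnm_lepP => i; rewrite !(mnm_nth 0%N) gl.
by case: (boolP (_ \in _)) => // /mem_take/(allP ms).
Qed.

Lemma not_hankel_ideal x : ~ I x <-> phi x != 0.
Proof. by rewrite hankel_idealE; split=> /eqP. Qed.

(** [I] is the kernel of a morphism to a domain, so products of multipliers outside [I] stay
    outside. *)
Lemma symbolic_ideal s : is_ideal (symbolic_power I s).
Proof.
have [e0 eD eM] := ideal_exp_ideal I s; split.
- exists 1; last by rewrite mulr0.
  by apply/not_hankel_ideal; rewrite rmorph1 oner_neq0.
- move=> x y [f If fx] [g Ig gy]; exists (f * g).
    by move: If Ig; rewrite !not_hankel_ideal rmorphM mulf_eq0 negb_or => -> ->.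
  rewrite mulrDr; apply: eD; last by rewrite -mulrA; apply: eM.
  by rewrite mulrAC [_ * g]mulrC; apply: eM.
- by move=> a x [f If fx]; exists f; rewrite // mulrCA; apply: eM.
Qed.

Lemma symbolic_mul s1 s2 x y : symbolic_power I s1 x -> symbolic_power I s2 y ->
  symbolic_power I (s1 + s2) (x * y).
Proof.
move=> [f If fx] [g Ig gy]; exists (f * g).
  by move: If Ig; rewrite !not_hankel_ideal rmorphM mulf_eq0 negb_or => -> ->.
by rewrite mulrACA; apply: ideal_expM.
Qed.

Lemma symbolic_zero x : symbolic_power I 0 x.
Proof. by exists 1 => //; apply/not_hankel_ideal; rewrite rmorph1 oner_neq0. Qed.

(* Multiplying a minor of size [r + d] by a power of its upper left [r]-minor,
   which is not in the ideal, gives a determinant of order [d] in the bordered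
   minors of size [r + 1]. *)
Lemma minor_symbolic d x : hankel_ideal K n c (r + d) x -> symbolic_power I d x.
Proof.
apply: ideal_gen_min; first exact: symbolic_ideal.
case: d => [|d]; first by move=> y _; apply: symbolic_zero.
move=> _ [f [g [f_incr g_incr ->]]]; set X := ext_hankel _ _ _ _.
set M : 'M_(r + d.+1) := mxsub f g X.
have ulE : ulsubmx M = mxsub (f \o lshift d.+1) (g \o lshift d.+1) X.
  by apply/matrixP => i j; rewrite !mxE.
(* Its leading monomial has degree [r], too small for a longer chain. *)
have phiA : phi (\det (ulsubmx M)) != 0.
  have [||||A0 lA] := @mlead_det K n c r (f \o lshift d.+1) (g \o lshift d.+1)
    (fun i j => hankel_index (f (lshift d.+1 i)) (g (lshift d.+1 j)))
    (ulsubmx M) c_gt0.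
  - by move=> i j; rewrite !mxE.
  - by [].
  - by move=> i j ij; apply: f_incr.
  - by move=> i j ij; apply: g_incr.
  apply: phi_neq0 => //; apply: chain_bound_mdeg; rewrite lA mdeg_sum.
  by under eq_bigr do rewrite mdeg1; rewrite sum1_card card_ord.
exists (\det (ulsubmx M) ^+ d.+1).
  by apply/not_hankel_ideal; rewrite rmorphXn expf_neq0.
rewrite -{2}[M]submxK schur_det.
have [_ _] := ideal_exp_ideal I d.+1; apply; apply: ideal_exp_det => i j.
(* Each entry of the Schur complement is treated by the same identity with one bordering row [i] and
   column [j], where an [(r + 1)]-minor appears and is killed by [phi]. *)
apply/hankel_idealE; apply: (mulfI phiA); rewrite mulr0 -rmorphM.
pose ext (k : 'I_d.+1) (l : 'I_(r + 1)) :=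
  match split l with inl l => lshift d.+1 l | inr _ => rshift r k end.
have := schur_det (ulsubmx M) (col j (ursubmx M)) (row i (dlsubmx M))
  (drsubmx M i j)%:M.
have -> : block_mx (ulsubmx M) (col j (ursubmx M)) (row i (dlsubmx M))
    (drsubmx M i j)%:M = mxsub (f \o ext i) (g \o ext j) X.
  apply/matrixP => k l; rewrite [RHS]mxE [LHS]mxE /ext /=.
  case: (split k) => k'; rewrite [LHS]mxE; case: (split l) => l'; rewrite !mxE //.
  by rewrite !ord1 eqxx mulr1n.
rewrite det_mx11 expr1 => /(congr1 phi); rewrite [phi (_ * \det (mxsub _ _ _))]rmorphM.
rewrite /X phi_minor ?addn1 // mulr0.
move=> E0; rewrite [RHS]E0; congr (phi (_ * _)).
rewrite !mxE eqxx mulr1n; congr (_ - _); apply: eq_bigr => k _.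
by rewrite !mxE; congr (_ * _); apply: eq_bigr => l _; rewrite !mxE.
Qed.
End SecantIdeal.

(** * Symbolic powers *)

Section Vanishing.
Variables (n : nat) (D : idomainType).
Implicit Types (p q : {mpoly D[n]}) (e : 'X_{1..n}).

Definition vanish s p : Prop := forall e, (mdeg e < s)%N -> p@_e = 0.

Lemma vanish_mul s1 s2 p q : vanish s1 p -> vanish s2 q -> vanish (s1 + s2) (p * q).
Proof.
move=> vp vq e es; rewrite mcoeffM big1 // => k /eqP eE.
have [k1|k1] := ltnP (mdeg k.1) s1; first by rewrite vp ?mul0r.
rewrite vq ?mulr0 // -(ltn_add2l s1); apply: leq_ltn_trans es.
by rewrite [leqRHS](congr1 mdeg eE) mdegD leq_add2r.
Qed.

Lemma vanish_ideal s : is_ideal (vanish s).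
Proof.
split.
- by move=> e _; rewrite mcoeff0.
- by move=> p q vp vq e es; rewrite mcoeffD vp ?vq ?addr0.
- by move=> a p vp; rewrite -[s]add0n; apply: vanish_mul.
Qed.

Lemma vanish1E p : p@_0 = 0 -> vanish 1 p.
Proof. by move=> p0 e; rewrite ltnS leqn0 mdeg_eq0 => /eqP->. Qed.

(** If [q] vanishes to order [s], then [p * q] and [p@_0] times [q] agree up to order [s + 1]. *)
Lemma vanish_cancel s p q : p@_0 != 0 -> vanish s (p * q) -> vanish s q.
Proof.
move=> p0; elim: s => [//|s IH] vpq.
have vq : vanish s q by apply: IH => e es; apply: vpq; apply: ltnW.
have [_ vD vM] := vanish_ideal s.+1.
have v1 : vanish 1 (p - (p@_0)%:MP).
  by apply: vanish1E; rewrite mcoeffB mcoeffC eqxx mulr1 subrr.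
have : vanish s.+1 (p * q + (-1) * ((p - (p@_0)%:MP) * q)).
  by apply: vD => //; apply: vM; rewrite -add1n; apply: vanish_mul.
rewrite mulN1r -mulrBl subKr => vz e es; apply/eqP.
have /eqP := vz e es; rewrite mcoeffCM mulf_eq0 => /orP[/eqP p00|//].
by rewrite p00 eqxx in p0.
Qed.

End Vanishing.

(** With weights [U_(i)], translation is the Taylor expansion in [n] independent variables at the
    point given by [phi]. *)
Lemma translate_coeff0 (K : comNzRingType) (n : nat) (D : comNzRingType)
    (phi : {rmorphism {mpoly K[n]} -> D}) f :
  (translate (fun i => U_(i))%MM phi f)@_0 = phi f.
Proof.
rewrite /translate /mmap raddf_sum [in RHS](mpolyE f) raddf_sum.
apply: eq_bigr => m _; rewrite /= mcoeffCM -mul_mpolyC rmorphM; congr (_ * _).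
rewrite mpolyXE_id /mmap1 !rmorph_prod; apply: eq_bigr => i _.
by rewrite !rmorphXn /= mcoeffD mcoeffC mcoeffX mnm1_eq0 eqxx mulr1 addr0.
Qed.

Lemma symbolic_mlead (K : fieldType) (n c r : nat) (D : idomainType)
    (phi : {rmorphism {mpoly K[n]} -> D}) (I : {mpoly K[n]} -> Prop) s x :
  (forall f, f != 0 -> chain_bound c r (mlead f) -> phi f != 0) ->
  (forall f, I f <-> phi f = 0) -> symbolic_power I s x -> x != 0 ->
  forall F : pred nat, (forall l, chain c l -> all F l -> (size l <= r)%N) ->
  (s <= \sum_(0 <= i < n | ~~ F i) nth 0 (mlead x) i)%N.
Proof.
move=> phi0 IE [f If fx] x0 F FP; pose psi : {rmorphism {mpoly K[n]} -> {mpoly D[n]}} :=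
  translate (fun i => U_(i))%MM phi.
have psi0 f' : (psi f')@_0 = phi f' by exact: translate_coeff0.
have v_exp k y : ideal_exp I k y -> vanish k (psi y).
  elim: k y => [//|k IH] y; have [v0 vD vM] := vanish_ideal n D k.+1.
  apply: (@ideal_gen_min _ _ (fun y => vanish k.+1 (psi y))).
    split; first by rewrite rmorph0.
    - by move=> a b va vb; rewrite rmorphD; apply: vD.
    - by move=> a b vb; rewrite rmorphM; apply: vM.
  move=> _ [a [b [Ia /IH vb ->]]]; rewrite rmorphM -add1n; apply: vanish_mul => //.
  by apply: vanish1E; rewrite psi0; apply/IE.
(* The multiplier [f] is outside [I], so [psi f] has a non-zero constant term and cancels. *)
have vx : vanish s (psi x).
  apply: (@vanish_cancel _ _ _ (psi f)); last by rewrite -rmorphM; apply: v_exp.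
  by rewrite psi0; apply/eqP => f0; apply: If; apply/IE.
pose m1 : 'X_{1..n} := [multinom if F i then mlead x i else 0%N | i < n].
pose m2 : 'X_{1..n} := [multinom if F i then 0%N else mlead x i | i < n].
have weightE (a : 'X_{1..n}) : weight (fun i => U_(i))%MM a = a.
  by rewrite [RHS]multinomUE_id.
have [|||g0 gl] := @mlead_taylor K n n (fun i => U_(i))%MM x m1 m2 x0.
- by apply/mnmP => i; rewrite mnmDE !mnmE; case: ifP; rewrite ?addn0.
- by move=> i; rewrite !mnmE; case: ifP; [right | left].
- by move=> a; rewrite !weightE => ->.
have cm1 : chain_bound c r m1.
  move=> l cl ml; apply: FP => //; apply/allP => i /(allP ml).
  case: (ltnP i n) => ni; last by rewrite nth_mnm_default.
  by rewrite nth_mnm mnmE; case: ifP.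
(* Thus [psi x] has a non-zero coefficient at [m2], whose degree must be at least [s]. *)
have : phi (taylor (fun i => U_(i))%MM x (weight (fun i => U_(i))%MM m2)) != 0.
  by apply: phi0 => //; rewrite gl.
rewrite -translate_coeff weightE.
have -> : (\sum_(0 <= i < n | ~~ F i) nth 0 (mlead x) i = mdeg m2)%N.
  rewrite mdegE big_mkord big_mkcond; apply: eq_bigr => i _.
  by rewrite -mnm_nth mnmE; case: (F i).
rewrite leqNgt; apply: contraNN => /vx v2.
by apply/eqP; exact: v2.
Qed.

(** * Products of minors and the two inclusions *)

Lemma ideal_prod_step (R : comNzRingType) (I : nat -> R -> Prop) (a : nat -> nat)
    (r : seq nat) k x y : uniq r -> k \in r -> I k y ->
  (\big[@ideal_mul R/@ideal_one R]_(j <- r) ideal_exp (I j) (a j)) x ->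
  (\big[@ideal_mul R/@ideal_one R]_(j <- r) ideal_exp (I j) (a j + (j == k))%N)
    (y * x).
Proof.
move=> + + Iy; elim: r x => [//|j r IH] x /= /andP[jr ur]; rewrite inE !big_cons.
have [e0 eD eM] := ideal_gen_ideal (fun x => exists u v,
   [/\ ideal_exp (I j) (a j + (j == k))%N u,
    (\big[@ideal_mul R/@ideal_one R]_(j <- r) ideal_exp (I j) (a j + (j == k))%N) v
    & x = u * v]).
move=> kjr; apply: (@ideal_gen_min _ _ (fun x => ideal_mul _ _ (y * x))).
  split; first by rewrite mulr0.
  - by move=> z t Jz Jt; rewrite mulrDr; apply: eD.
  - by move=> b z Jz; rewrite mulrCA; apply: eM.
move=> _ [u [v [Iu Iv ->]]]; case/orP: kjr => [/eqP kj|kr].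
  rewrite -{}kj in jr Iu Iv *; rewrite mulrA; apply: ideal_mul_sub.
    by rewrite eqxx addn1; apply: ideal_mul_sub.
  move: Iv; rewrite (eq_big_seq (fun j => ideal_exp (I j) (a j + (j == k)))) //.
  by move=> i ir; case: eqP => [ik|]; [rewrite -ik ir in jr | rewrite addn0].
rewrite mulrCA; apply: ideal_mul_sub; last exact: IH.
by case: eqP => [jk|]; [rewrite jk kr in jr | rewrite addn0].
Qed.

Lemma ideal_prod_one (R : comNzRingType) (I : nat -> R -> Prop) (r : seq nat) :
  (\big[@ideal_mul R/@ideal_one R]_(j <- r) ideal_exp (I j) 0) 1.
Proof.
elim: r => [|j r IH]; first by rewrite big_nil.
by rewrite big_cons -[1]mul1r; apply: ideal_mul_sub.
Qed.

(** The last element exceeds the first by at least [c + 1] per step. Hence every chain belongs to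
    some [I_k] with [k <= m]. *)
Lemma chain_size c n s : chain c s -> all (fun i => i < n)%N s ->
  (size s <= (n + c) %/ (c + 1))%N.
Proof.
case: s => [//|x s] cs sn; rewrite addn1 leq_divRL //.
have lt : (0 + size s < size (x :: s))%N by [].
have := chain_nth cs lt; have /= := allP sn _ (mem_nth 0%N lt).
rewrite add0n /= !mulnS; lia.
Qed.

(** [g] is the product of the minors of the chains in [P], and [a k] counts the chains of length
    [k]. *)
Lemma packing_product (K : fieldType) (n c r m : nat) (P : seq (seq nat)) :
  (0 < c)%N -> m = ((n + c) %/ (c + 1))%N ->
  all (fun l => [&& chain c l, r < size l & all (fun i => i < n) l])%N P ->
  exists (a : nat -> nat) (g : {mpoly K[n]}),
    [/\ (\sum_(r.+1 <= k < m.+1) (k - r) * a k)%N = (\sum_(l <- P) (size l - r))%N,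
        (\big[@ideal_mul _/@ideal_one _]_(r.+1 <= k < m.+1)
           ideal_exp (hankel_ideal K n c k) (a k)) g, g != 0
      & forall i, nth 0%N (mlead g) i = (\sum_(l <- P) (i \in l))%N].
Proof.
move=> c0 mE; elim: P => [_|l P IH /= /andP[/and3P[cl rl ln] /IH[a [g [as_ ag g0 gl]]]]].
  exists (fun=> 0%N), 1; rewrite big_nil; split.
  - by rewrite big1 // => i _; rewrite muln0.
  - exact: ideal_prod_one.
  - exact: oner_neq0.
  - move=> i; rewrite big_nil mlead1; case: (ltnP i n) => ni.
      by rewrite nth_mnm mnm0E.
    by rewrite nth_mnm_default.
have lm : (size l <= m)%N by rewrite mE; apply: chain_size.
have lr : size l \in index_iota r.+1 m.+1 by rewrite mem_index_iota rl.
have [h [hm h0 hl]] := chain_minor K c0 cl ln erefl.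
exists (fun k => a k + (k == size l))%N, (h * g); split.
- rewrite big_cons -as_ addnC; under eq_bigr do rewrite mulnDr.
  rewrite big_split; congr (_ + _)%N.
  rewrite (bigD1_seq _ lr (iota_uniq _ _)) /= eqxx muln1 big1 ?addn0 // => k.
  by move/negbTE=> ->; rewrite muln0.
- apply: ideal_prod_step => //; first exact: iota_uniq.
  exact: ideal_gen_sub.
- by rewrite mulf_neq0.
move=> i; rewrite big_cons -gl -hl mleadM //; case: (ltnP i n) => ni.
  by rewrite !nth_mnm mnmDE.
by rewrite !nth_mnm_default.
Qed.

Theorem theorem3p16 (K : fieldType) (n c : nat) (hn : (1 <= n)%N)
    (hc : (1 <= c)%N) (m : nat) (hm : m = ((n + c) %/ (c + 1))%N)
    (t : nat) (ht : (1 <= t <= m)%N) (s : nat) (x : {mpoly K[n]}) :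
  symbolic_power (hankel_ideal K n c t) s x <->
  ideal_sum
    (fun a : nat -> nat => (\sum_(t <= k < m.+1) (k - t + 1) * a k)%N = s)
    (fun a : nat -> nat =>
       \big[@ideal_mul _/@ideal_one _]_(t <= k < m.+1)
         ideal_exp (hankel_ideal K n c k) (a k)) x.
Proof.
case: t ht => [//|r] /andP[_ rm].
have [D [phi [u [v [phiX phi0]]]]] := @secant_morphism K n c r hc.
have sidl := symbolic_ideal hc phiX phi0.
have smul := symbolic_mul hc phiX phi0.
set I := hankel_ideal K n c r.+1 in sidl smul *.
set J := ideal_sum _ _.
have weightE (a : nat -> nat) : (\sum_(r.+1 <= k < m.+1) (k - r.+1 + 1) * a k =
    \sum_(r.+1 <= k < m.+1) (k - r) * a k)%N.
  rewrite big_nat_cond [RHS]big_nat_cond; apply: eq_bigr => k.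
  by rewrite andbT => ?; congr (_ * _)%N; lia.
have mulS (A B : {mpoly K[n]} -> Prop) s1 s2 : (forall y, A y -> symbolic_power I s1 y) ->
    (forall y, B y -> symbolic_power I s2 y) ->
    forall y, ideal_mul A B y -> symbolic_power I (s1 + s2) y.
  move=> AS BS; apply: ideal_gen_min => // _ [a [b [/AS sa /BS sb ->]]].
  exact: smul.
have expS k w : (r < k)%N -> forall y, ideal_exp (hankel_ideal K n c k) w y ->
    symbolic_power I ((k - r) * w) y.
  move=> rk; elim: w => [|w IH] y; first by
    rewrite muln0 => _; apply: symbolic_zero phiX phi0 _.
  rewrite mulnS; apply: mulS => // {}y yk; apply: (minor_symbolic hc phiX phi0).
  by rewrite subnKC // ltnW.
(* Right to left: [I_k] lies in the symbolic power of order [k - r], and these orders add up under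
   products. *)
have JS y : J y -> symbolic_power I s y.
  apply: ideal_gen_min => // {}y [a <-]; rewrite weightE /index_iota.
  have : all (fun k => r < k)%N (iota r.+1 (m.+1 - r.+1)).
    by apply/allP => k; rewrite mem_iota => /andP[].
  elim: (iota _ _) y => [|k l IH] y /=; rewrite ?big_nil ?big_cons.
    by move=> _ _; apply: symbolic_zero phiX phi0 _.
  move=> /andP[rk rl]; apply: mulS; first exact: expS.
  by move=> {}y; apply: IH.
split; last exact: JS.
(* Left to right by division: a packing of the leading monomial of [f] yields a product of minors in
   [J] whose leading monomial divides it. *)
apply: (@lead_reduction _ _ (symbolic_power I s)).
- exact: ideal_gen_ideal.
- move=> f g sf /JS sg; have [_ sD sM] := sidl s.
  by rewrite -mulN1r; apply: sD => //; apply: sM.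
move=> f sf f0.
have lowF := symbolic_mlead phi0 (hankel_idealE hc phiX phi0) sf f0.
have a0 i : (n <= i)%N -> nth 0%N (mlead f) i = 0%N by apply: nth_mnm_default.
have [P [chP wP aP]] := chain_packing a0 lowF.
have [a [g [wa ag g0 gl]]] := packing_product K hc hm chP.
exists g; split=> //.
  by apply: ideal_gen_sub; exists a => //; rewrite weightE wa.
by apply/mnm_lepP => i; rewrite !(mnm_nth 0%N) gl.
Qed.
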